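(* Let $\varepsilon\in(0,1)$ and $\delta=\varepsilon/p$ with $\varepsilon>1/p^B$ for some $B>0$. If $\theta\in\mathbb{R}^p$ is drawn from the continuous shrinkage prior described in the context and $s\gtrsim\log p$, then there exists a constant $A>0$ such that $$\mathbb{P}\bigl(|\mathrm{supp}_\delta(\theta)|>As\bigr)\le e^{-Cs}$$ for some constant $C>0$. Moreover, the constant $C$ appearing in the exponent can be made arbitrarily large by choosing $A$ large enough.
   Context: For $\delta>0$ and $\theta\in\mathbb{R}^p$, $\mathrm{supp}_\delta(\theta)=\{j:|\theta_j|>\delta\}$, and $|S|$ denotes the cardinality of a set $S$. $s\gtrsim\log p$ means $s\ge c\log p$ for a global constant $c>0$. The constants $A,C$ do not depend on $p,s,\varepsilon$. Continuous shrinkage prior on $\theta\in\mathbb{R}^p$: conditionally on $\tau,\gamma$, the entries are independent with $\theta_j\sim\mathrm{DE}(\tau\gamma_j)$, where $\mathrm{DE}(\psi)$ is the Laplace distribution with density $\frac1{2\psi}e^{-|x|/\psi}$, $x\in\mathbb{R}$; $\tau>0$ is exponential with rate $1/2$ (density $\frac12e^{-t/2}$); and, independently, $\gamma=(\gamma_1,\ldots,\gamma_p)$ is drawn from the Dirichlet distribution $\mathrm{Dir}(\alpha/p,\ldots,\alpha/p)$ on the probability simplex (that is, $(\gamma_1,\ldots,\gamma_{p-1})$ has the Dirichlet density and $\gamma_p=1-\sum_{j<p}\gamma_j$), with $\alpha>0$ a fixed constant. *)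

(* Defs.v *)
From HB Require Import structures.
From mathcomp Require Import all_boot all_order all_algebra.
From mathcomp Require Import all_classical all_reals all_analysis.

Set Implicit Arguments.
Unset Strict Implicit.
Unset Printing Implicit Defensive.

Import Order.TTheory GRing.Theory Num.Theory.
Import numFieldNormedType.Exports.

Local Open Scope classical_set_scope.
Local Open Scope ring_scope.

Section distributions.
Context {R : realType}.
Local Notation mu := (@lebesgue_measure R).

(* The integral over R^n as an iterated one-dimensional integral. For
   nonnegative measurable f (the only use below) this is, by Tonelli, the
   integral with respect to n-dimensional Lebesgue measure. *)
Fixpoint integral_Rn (n : nat) : (n.-tuple R -> \bar R) -> \bar R :=
  match n with
  | 0 => fun f => f [tuple]
  | m.+1 => fun f =>
      (\int[mu]_x integral_Rn (fun y : m.-tuple R => f [tuple of x :: y]))%E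
  end.

Definition Gamma_fun (a : R) : R :=
  \int[mu]_(x in `]0, +oo[) (x `^ (a - 1) * expR (- x)).

Definition simplex_point (n : nat) (x : n.-tuple R) : n.+1.-tuple R :=
  [tuple of rcons x (1 - \sum_(i < n) tnth x i)].

(* Density of the first n coordinates of a Dirichlet vector with n + 1
   coordinates. *)
Definition dirichlet_pdf (n : nat) (a : 'I_n.+1 -> R) (x : n.-tuple R) : R :=
  let g := simplex_point x in
  if [forall j, 0 < tnth g j] then
    Gamma_fun (\sum_j a j) / (\prod_j Gamma_fun (a j)) *
      \prod_j (tnth g j) `^ (a j - 1)
  else 0.

(* The law on R^(n+1) of the full vector, whose last coordinate is 1 minus the
   sum of the others: the image of the density above by simplex_point. *)
Definition dirichlet_law (n : nat) (a : 'I_n.+1 -> R)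
    (E : set (n.+1.-tuple R)) : \bar R :=
  integral_Rn (fun x : n.-tuple R =>
    (dirichlet_pdf a x * \1_E (simplex_point x))%:E).

Definition laplace_pdf (psi x : R) : R :=
  (2 * psi)^-1 * expR (- (`|x| / psi)).

Definition laplace_law (psi : R) (E : set R) : \bar R :=
  (\int[mu]_(x in E) (laplace_pdf psi x)%:E)%E.

End distributions.

Section prior.
Context {R : realType}.

Definition is_shrinkage_prior (alpha : R) (n : nat) (d : measure_display)
    (T : measurableType d) (P : probability T R) (tau : {RV P >-> R})
    (gamma theta : {RV P >-> n.+1.-tuple R}) : Prop :=
  [/\ (forall D : set R, measurable D ->
         distribution P tau D = exponential_prob 2^-1 D),
      (forall E : set (n.+1.-tuple R), measurable E ->
         distribution P gamma E =
         dirichlet_law (fun _ : 'I_n.+1 => alpha / n.+1%:R) E),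
      (forall (D : set R) (E : set (n.+1.-tuple R)),
         measurable D -> measurable E ->
         P (tau @^-1` D `&` gamma @^-1` E) =
         (P (tau @^-1` D) * P (gamma @^-1` E))%E) &
      (* Conditionally on (tau, gamma), the theta_j are independent with laws
         DE(tau * gamma_j): the defining identity of the conditional law,
         tested on events of (tau, gamma) and on boxes for theta. The value of
         laplace_law at nonpositive scales is irrelevant, since
         tau * gamma_j > 0 almost surely. *)
      (forall (D : set (R * n.+1.-tuple R)) (B : 'I_n.+1 -> set R),
         measurable D -> (forall j, measurable (B j)) ->
         P [set w | D (tau w, gamma w) /\ forall j, B j (tnth (theta w) j)] =
         (\int[P]_(w in [set w | D (tau w, gamma w)])
            \prod_(j < n.+1) laplace_law (tau w * tnth (gamma w) j)%R (B j))%E)].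

Definition supp_gt (p : nat) (delta : R) (theta : p.-tuple R) : {set 'I_p} :=
  [set j | delta < `|tnth theta j|]%SET.

(* The dimension is p = n + 1. The bound is uniform in p, eps and s, so that
   A and C may depend only on alpha and on the constants B and c of the
   conditions eps > p^(-B) and s >= c log p. *)
Definition supp_tail_bound (alpha B c A C : R) : Prop :=
  forall (n : nat) (eps s : R) (d : measure_display) (T : measurableType d)
    (P : probability T R) (tau : {RV P >-> R})
    (gamma theta : {RV P >-> n.+1.-tuple R}),
  is_shrinkage_prior alpha tau gamma theta ->
  0 < eps < 1 ->
  (n.+1%:R `^ B)^-1 < eps ->
  c * ln n.+1%:R <= s ->
  (P [set w | (A * s < #|supp_gt (eps / n.+1%:R) (theta w)|%:R)%R] <=
   (expR (- (C * s)))%:E)%E.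

End prior.

(* Main.v *)
Require Import Defs.
From mathcomp Require Import all_boot all_order all_algebra.
From mathcomp Require Import all_classical all_reals all_analysis.
From mathcomp Require Import measurable_realfun ring lra.

Import Order.TTheory GRing.Theory Num.Theory.
Import numFieldNormedType.Exports.

Local Open Scope classical_set_scope.
Local Open Scope ring_scope.

Set Implicit Arguments.
Unset Strict Implicit.
Unset Printing Implicit Defensive.

(** Put p = n + 1 and a = alpha / p. A coordinate j with |theta_j| > delta has
    either a heavy weight, gamma_j > u, or a light one, where u is of the order of a
    power of 1/p; if more than A s coordinates are large, more than A s / 2 of
    them are of one kind. Outside an event of probability exp (- t / 2), tau <= t.
    Take t = 2 L p for a large constant L: as the bound is trivial unless
    s <= p, this probability is at most exp (- L s).

    Light coordinates. Given tau and gamma, each of them is large with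
    probability at most exp (- delta / (t u)) <= exp (- p) <= 1 / p,
    independently. A union bound over the sets of k coordinates gives
    'C(p, k) p^(-k), which is super-exponentially small in k (light_count).

    Heavy coordinates. If G_1, ..., G_p are independent Gamma(a) variables and
    Sigma is their sum, then gamma = G / Sigma is independent of Sigma. On
    Sigma >= 1, gamma_j > u forces G_j > u, so P (gamma_j > u for all j in S) is
    at most P (G_1 > u)^#|S| / P (Sigma >= 1). Since the density of G_1 is about
    a x^(-1) near 0, P (G_1 > u) = O (a ln (1 / u)) = O (ln p / p), and the union
    bound over the sets S of size k gives exp (O (ln p) - k) (heavy_count,
    bin_pow_le). As s >= c ln p, a large constant A makes k > A s / 2 dominate.

    The change of variables (G_j)_j -> (gamma, Sigma) is replaced by
    one-dimensional facts on iterated convolutions. Let D(r) be the convolution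
    of functions phi_0, ..., phi_n at r, so that the Dirichlet integral is D(1).
    If no x phi_j(x) decreases when x is multiplied by a number >= 1, neither
    does r D(r) (iter_conv_scale); and the integral of exp (- r) D(r) is the
    product of those of exp (- x) phi_j(x) (integral_exp_iter_conv). Integrating
    over [1, 2] bounds D(1) by a constant times this product (iter_conv1_le). *)

(** * Integration tools *)

Section integral_tools.
Context d (T : measurableType d) (R : realType) (m : {measure set T -> \bar R}).
Local Open Scope ereal_scope.

(** The integral of any nonnegative function is the supremum over the simple
    functions below it, hence monotone. *)
Lemma le_integral_nneg (D : set T) (f g : T -> \bar R) :
  (forall x, D x -> 0 <= f x) -> (forall x, D x -> f x <= g x) ->
  \int[m]_(x in D) f x <= \int[m]_(x in D) g x.
Proof.
move=> f0 fg; have g0 x : D x -> 0 <= g x.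
  by move=> Dx; exact: le_trans (f0 _ Dx) (fg _ Dx).
rewrite !ge0_integralE//; apply: ereal_sup_le => _ [h hf <-].
exists h => // x; apply: le_trans (hf x) _.
rewrite /patch; case: ifPn => // /set_mem; exact: fg.
Qed.

End integral_tools.

Section lebesgue.
Context {R : realType}.
Local Notation mu := (@lebesgue_measure R).
Local Open Scope ereal_scope.

Lemma lee_prod_nneg (I : finType) (f g : I -> \bar R) :
  (forall i, 0 <= f i <= g i) -> \prod_i f i <= \prod_i g i.
Proof.
move=> fg; suff /andP[] : 0 <= \prod_i f i <= \prod_i g i by [].
elim/big_ind2 : _ => // [|x y z t /andP[x0 xy] /andP[z0 zt]].
  by rewrite lexx lee01.
by rewrite mule_ge0// lee_pmul.
Qed.

Lemma measurable_affine (c b : R) :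
  measurable_fun [set: R] (fun x => c * x + b)%R.
Proof. by apply: measurable_funD => //; exact: measurable_funM. Qed.

(** The image of Lebesgue measure under x |-> c x + b, scaled by |c|, agrees
    with Lebesgue measure on intervals, hence everywhere. The case c = - 1 is
    the reflection used for the Laplace law. *)
Lemma integral_affine (c b : R) (f : R -> \bar R) : c != 0%R ->
  measurable_fun [set: R] f -> (forall x, 0 <= f x) ->
  \int[mu]_x f x = `|c|%:E * \int[mu]_x f (c * x + b)%R.
Proof.
move=> c0 mf f0.
pose h (x : measurableTypeR R) : measurableTypeR R := (c * (x : R) + b)%R.
have mh : measurable_fun [set: measurableTypeR R] h by exact: measurable_affine.
pose nu0 := mscale (NngNum (normr_ge0 c)) (pushforward mu h).
pose nu : {measure set (measurableTypeR R) -> \bar R} := nu0 mh.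
have nuE A : measurable A -> mu A = nu A.
  apply: lebesgue_measure_unique => /= _ [[u v]] _ <-.
  rewrite [RHS](_ : _ = `|c|%:E * mu (h @^-1` [set` `]u, v]%R]))//.
  rewrite lebesgue_measure_itv /= lte_fin.
  have [c_gt0|c_lt0|c_eq0] := ltgtP 0%R c; last by rewrite -c_eq0 eqxx in c0.
  - rewrite [h @^-1` _](_ : _ = [set` `](u - b) / c, (v - b) / c]%R]);
      last first.
      apply/seteqP; split=> x /=;
        rewrite /h !in_itv/= ltr_pdivrMr// ler_pdivlMr//;
        by rewrite ltrBlDr lerBrDr [(c * x)%R]mulrC.
    rewrite lebesgue_measure_itv /= lte_fin ltr_pM2r ?invr_gt0// ltrD2r.
    case: ifPn => uv; last by rewrite mule0.
    by rewrite -!EFinB -EFinM gtr0_norm//; congr EFin; field.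
  - rewrite [h @^-1` _](_ : _ = [set` `[(v - b) / c, (u - b) / c[%R]);
      last first.
      apply/seteqP; split=> x /=;
        rewrite /h !in_itv/= ler_ndivrMr// ltr_ndivlMr//;
        by rewrite ltrBlDr lerBrDr [(c * x)%R]mulrC andbC.
    rewrite lebesgue_measure_itv /= lte_fin ltr_nM2r ?invr_lt0// ltrD2r.
    case: ifPn => uv; last by rewrite mule0.
    by rewrite -!EFinB -EFinM ltr0_norm//; congr EFin; field.
rewrite (@eq_measure_integral _ _ _ _ nu); last by move=> A mA _; exact: nuE.
rewrite ge0_integral_mscale//=.
by congr (_ * _); rewrite ge0_integral_pushforward.
Qed.
End lebesgue.

(** * Iterated convolutions *)

Section iter_conv.
Context {R : realType}.
Local Notation mu := (@lebesgue_measure R).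
Local Open Scope ereal_scope.

(** The convolution phi_0 * ... * phi_n, associated so that it unfolds along the
    iterated integral over R^n. *)
Fixpoint iter_conv (n : nat) : ('I_n.+1 -> R -> R) -> R -> \bar R :=
  match n with
  | 0 => fun phi r => (phi ord0 r)%:E
  | m.+1 => fun phi r =>
      \int[mu]_x ((phi ord0 x)%:E *
                  iter_conv (fun j : 'I_m.+1 => phi (lift ord0 j)) (r - x)%R)
  end.

Lemma iter_conv_ge0 n (phi : 'I_n.+1 -> R -> R) r :
  (forall j x, 0 <= phi j x)%R -> 0 <= iter_conv phi r.
Proof.
elim: n phi r => [|n IH] phi r p0 /=; first by rewrite lee_fin.
by apply: integral_ge0 => x _; rewrite mule_ge0 ?lee_fin// IH.
Qed.

Lemma measurable_iter_conv n (phi : 'I_n.+1 -> R -> R) :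
  (forall j x, 0 <= phi j x)%R -> (forall j, measurable_fun [set: R] (phi j)) ->
  measurable_fun [set: R] (iter_conv phi).
Proof.
elim: n phi => [|n IH] phi p0 mphi /=; first exact/measurable_EFinP.
pose psi (j : 'I_n.+1) := phi (lift ord0 j).
pose f (z : R * R) := (phi ord0 z.2)%:E * iter_conv psi (z.1 - z.2)%R.
apply: (measurable_fun_fubini_tonelli_F (m2 := mu) f).
- apply: emeasurable_funM; first exact/measurable_EFinP/measurableT_comp.
  apply: (@measurableT_comp _ _ _ _ _ _ (iter_conv psi)).
    by apply: IH => [j x|j]; [exact: p0|exact: mphi].
  exact: measurable_funB.
- by move=> z; rewrite mule_ge0 ?lee_fin ?iter_conv_ge0// => j x; exact: p0.
Qed.

(** Each of the n integrations contributes a factor r by the dilation x |-> r x,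
    and each of the n + 1 functions a factor 1 / r: the product is 1 / r for
    every n. *)
Lemma iter_conv_scale n (phi : 'I_n.+1 -> R -> R) (r z : R) : (1 <= r)%R ->
  (forall j x, 0 <= phi j x)%R -> (forall j, measurable_fun [set: R] (phi j)) ->
  (forall j x, phi j x <= r * phi j (r * x))%R ->
  iter_conv phi z <= r%:E * iter_conv phi (r * z)%R.
Proof.
move=> r1; have r0 : (0 < r)%R by apply: lt_le_trans r1.
elim: n phi z => [|n IH] phi z p0 mphi pr /=; first by rewrite -EFinM lee_fin.
set psi := fun j : 'I_n.+1 => phi (lift ord0 j).
have psi0 j x : (0 <= psi j x)%R by exact: p0.
have mpsi j : measurable_fun [set: R] (psi j) by exact: mphi.
have mconv : measurable_fun [set: R] (iter_conv psi).
  exact: measurable_iter_conv.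
rewrite [X in _ <= _ * X](@integral_affine _ r 0) ?gt_eqF//; last 2 first.
- apply: emeasurable_funM; first exact/measurable_EFinP.
  apply: (@measurableT_comp _ _ _ _ _ _ (iter_conv psi)) => //.
  exact: measurable_funB.
- by move=> x; rewrite mule_ge0 ?lee_fin ?iter_conv_ge0.
rewrite gtr0_norm// muleA -EFinM -ge0_integralZl_EFin//; last 3 first.
- by move=> x _; rewrite mule_ge0 ?lee_fin ?iter_conv_ge0.
- apply: emeasurable_funM.
    apply/measurable_EFinP; apply: measurableT_comp => //.
    by apply: measurable_funD => //; exact: measurable_funM.
  apply: (@measurableT_comp _ _ _ _ _ _ (iter_conv psi)) => //.
  apply: measurable_funB => //.
  by apply: measurable_funD => //; exact: measurable_funM.
- by rewrite mulr_ge0// ltW.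
apply: le_integral_nneg => x _.
  by rewrite mule_ge0 ?lee_fin ?iter_conv_ge0.
rewrite EFinM addr0 -mulrBr muleACA -EFinM lee_pmul ?lee_fin ?iter_conv_ge0//.
by apply: IH => // j y; exact: pr.
Qed.

(** The Laplace transform at 1 turns convolutions into products. *)
Lemma integral_exp_iter_conv n (phi : 'I_n.+1 -> R -> R) :
  (forall j x, 0 <= phi j x)%R -> (forall j, measurable_fun [set: R] (phi j)) ->
  \int[mu]_r ((expR (- r))%:E * iter_conv phi r) =
  \prod_(j < n.+1) \int[mu]_x (expR (- x) * phi j x)%:E.
Proof.
have mexp : measurable_fun [set: R] (fun x : R => expR (- x)).
  by apply: measurableT_comp.
elim: n phi => [|n IH] phi p0 mphi /=; first by rewrite big_ord1.
rewrite big_ord_recl.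
set psi := fun j : 'I_n.+1 => phi (lift ord0 j).
have psi0 j x : (0 <= psi j x)%R by exact: p0.
have mpsi j : measurable_fun [set: R] (psi j) by exact: mphi.
have mconv : measurable_fun [set: R] (iter_conv psi).
  exact: measurable_iter_conv.
have e0 x : 0 <= (expR x)%:E :> \bar R by rewrite lee_fin expR_ge0.
have mF (r : R) :
    measurable_fun [set: R] (fun x => (phi ord0 x)%:E * iter_conv psi (r - x)).
  apply: emeasurable_funM; first exact/measurable_EFinP.
  apply: (@measurableT_comp _ _ _ _ _ _ (iter_conv psi)) => //.
  exact: measurable_funB.
transitivity (\int[mu]_r \int[mu]_x
    ((expR (- r))%:E * ((phi ord0 x)%:E * iter_conv psi (r - x)))).
  apply: eq_integral => r _; rewrite -ge0_integralZl_EFin ?expR_ge0//.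
    by move=> x _; rewrite mule_ge0 ?lee_fin ?iter_conv_ge0.
  exact: mF.
pose f (z : R * R) :=
  (expR (- z.1))%:E * ((phi ord0 z.2)%:E * iter_conv psi (z.1 - z.2)%R).
have mf : measurable_fun setT f.
  apply: emeasurable_funM.
    by apply/measurable_EFinP; exact: (measurableT_comp mexp).
  apply: emeasurable_funM; first exact/measurable_EFinP/measurableT_comp.
  apply: (@measurableT_comp _ _ _ _ _ _ (iter_conv psi)) => //.
  exact: measurable_funB.
have f0 z : 0 <= f z by rewrite !mule_ge0 ?lee_fin ?iter_conv_ge0.
transitivity (\int[mu]_x \int[mu]_r f (r, x)).
  exact: (fubini_tonelli (m1 := mu) (m2 := mu) f mf f0).
rewrite -IH//.
have mG : measurable_fun [set: R] (fun r => (expR (- r))%:E * iter_conv psi r).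
  by apply: emeasurable_funM => //; exact/measurable_EFinP.
set I := (X in _ * X).
rewrite -ge0_integralZr//; last 3 first.
- by apply/measurable_EFinP; exact: (measurable_funM mexp (mphi ord0)).
- by move=> x _; rewrite lee_fin mulr_ge0 ?expR_ge0.
- by apply: integral_ge0 => x _; rewrite mule_ge0 ?iter_conv_ge0.
apply: eq_integral => x _ /=.
rewrite (@integral_affine _ 1 x).
- rewrite normr1 mul1e -ge0_integralZl_EFin ?mulr_ge0 ?expR_ge0//; last first.
    by move=> y _; rewrite mule_ge0 ?iter_conv_ge0.
  apply: eq_integral => y _; rewrite /f /=.
  rewrite mul1r addrK opprD expRD !EFinM.
  by rewrite (muleC (expR (- y))%:E (expR (- x))%:E) muleACA.
- by rewrite oner_eq0.
- apply: (@measurableT_comp _ _ _ _ _ _ f) => //; exact: measurable_fun_pair.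
- by [].
Qed.

(** The last argument r - sum x_i is the coordinate that the simplex constraint
    fixes. The total r is kept free because peeling off x_0 turns it into
    r - x_0. *)
Lemma integral_Rn_prod n (phi : 'I_n.+1 -> R -> R) (K r : R) : (0 <= K)%R ->
  (forall j x, 0 <= phi j x)%R -> (forall j, measurable_fun [set: R] (phi j)) ->
  integral_Rn (fun x : n.-tuple R =>
    (K * \prod_j
       phi j (tnth [tuple of rcons x (r - \sum_(i < n) tnth x i)] j))%:E) =
  K%:E * iter_conv phi r.
Proof.
elim: n phi K r => [|n IH] phi K r K0 p0 mphi /=.
  by rewrite big_ord1 big_ord0 subr0 EFinM.
pose psi (j : 'I_n.+1) := phi (lift ord0 j).
have psi0 j x : (0 <= psi j x)%R by exact: p0.
have mpsi j : measurable_fun [set: R] (psi j) by exact: mphi.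
have mF : measurable_fun [set: R]
    (fun x => (phi ord0 x)%:E * iter_conv psi (r - x)%R).
  apply: emeasurable_funM; first exact/measurable_EFinP.
  apply: (@measurableT_comp _ _ _ _ _ _ (iter_conv psi)).
    exact: measurable_iter_conv.
  exact: measurable_funB.
have F0 x : 0 <= (phi ord0 x)%:E * iter_conv psi (r - x)%R.
  by rewrite mule_ge0 ?lee_fin ?iter_conv_ge0.
transitivity (\int[mu]_x (K%:E * ((phi ord0 x)%:E * iter_conv psi (r - x)%R)));
  last exact: ge0_integralZl_EFin.
apply: eq_integral => x _.
rewrite muleA -EFinM -(IH psi) ?mulr_ge0//.
congr integral_Rn; apply/funext => y; congr EFin.
rewrite big_ord_recl -mulrA; congr (_ * (_ * _))%R.
apply: eq_bigr => j _; congr (phi _ _).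
rewrite big_ord_recl tnth0 opprD addrA.
under eq_bigr do rewrite tnthS.
by rewrite !(tnth_nth 0%R)/=.
Qed.

(** For r in [1, 2], the value at 1 is at most 2 exp 2 times exp (- r) times the
    value at r; integrate over r. *)
Lemma iter_conv1_le n (phi : 'I_n.+1 -> R -> R) :
  (forall j x, 0 <= phi j x)%R -> (forall j, measurable_fun [set: R] (phi j)) ->
  (forall r, 1 <= r -> forall j x, phi j x <= r * phi j (r * x))%R ->
  iter_conv phi 1%R <=
  (2 * expR 2)%:E * \prod_(j < n.+1) \int[mu]_x (expR (- x) * phi j x)%:E.
Proof.
move=> p0 mphi pr.
have c0 r : 0 <= iter_conv phi r by exact: iter_conv_ge0.
have mE : measurable_fun [set: R] (fun r => (expR (- r))%:E * iter_conv phi r).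
  apply: emeasurable_funM; last exact: measurable_iter_conv.
  by apply/measurable_EFinP; apply: measurableT_comp.
have E0 r : 0 <= (expR (- r))%:E * iter_conv phi r.
  by rewrite mule_ge0 ?lee_fin ?expR_ge0.
rewrite -integral_exp_iter_conv//.
rewrite -ge0_integralZl_EFin ?mulr_ge0 ?expR_ge0//.
have -> : iter_conv phi 1%R =
    \int[mu]_(r in `[1%R, 2%R]) cst (iter_conv phi 1%R) r.
  rewrite integral_cst//= lebesgue_measure_itv/= lte_fin ltr1n -EFinB.
  by rewrite (_ : 2 - 1 = 1)%R ?mule1//; ring.
apply: (@le_trans _ _ (\int[mu]_(r in `[1%R, 2%R])
   ((2 * expR 2)%:E * ((expR (- r))%:E * iter_conv phi r)))).
  apply: le_integral_nneg => r; first by move=> _; exact: c0.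
  rewrite /= in_itv/= => /andP[r1 r2].
  apply: (@le_trans _ _ (r%:E * iter_conv phi r)).
    rewrite -[X in _ <= _ * iter_conv phi X]mulr1.
    by apply: iter_conv_scale => // *; exact: pr.
  rewrite muleA -EFinM lee_wpmul2r// lee_fin -mulrA -expRD.
  have : (1 <= expR (2 - r))%R.
    by rewrite -[X in (X <= _)%R]expR0 ler_expR subr_ge0.
  nra.
apply: ge0_subset_integral => //.
- exact: emeasurable_funM.
- by move=> r _; rewrite mule_ge0// lee_fin mulr_ge0 ?expR_ge0.
Qed.

End iter_conv.

(** * Dirichlet probabilities of boxes *)

Section dirichlet.
Context {R : realType}.
Local Notation mu := (@lebesgue_measure R).
Local Open Scope ereal_scope.

Lemma Gamma_fun_ge0 (a : R) : (0 <= Gamma_fun a)%R.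
Proof.
rewrite fine_ge0// integral_ge0// => x _.
by rewrite lee_fin mulr_ge0 ?expR_ge0 ?powR_ge0.
Qed.

(** The Gamma(a) density restricted to x > v, without its factor exp (- x), whose
    product over the coordinates is constant on the simplex. *)
Definition cut_gamma (a v x : R) : R :=
  if (v < x)%R then (x `^ (a - 1) / Gamma_fun a)%R else 0%R.

Lemma cut_gamma_ge0 a v x : (0 <= cut_gamma a v x)%R.
Proof.
rewrite /cut_gamma; case: ifP => // _.
by rewrite divr_ge0 ?powR_ge0 ?Gamma_fun_ge0.
Qed.

Lemma measurable_cut_gamma a v : measurable_fun [set: R] (cut_gamma a v).
Proof.
apply: measurable_fun_ifT => //; first exact: measurable_fun_ltr.
by apply: measurable_funM => //; exact: measurable_powR.
Qed.

Lemma cut_gamma_scale a v r x : (0 <= a)%R -> (0 <= v)%R -> (1 <= r)%R ->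
  (cut_gamma a v x <= r * cut_gamma a v (r * x))%R.
Proof.
move=> a0 v0 r1; have r0 : (0 < r)%R by apply: lt_le_trans r1.
rewrite {1}/cut_gamma; case: ifPn => [vx|_]; last first.
  by rewrite mulr_ge0 ?cut_gamma_ge0// ltW.
have x0 : (0 < x)%R by exact: le_lt_trans vx.
have vrx : (v < r * x)%R by apply: lt_le_trans vx _; rewrite ler_peMl// ltW.
rewrite /cut_gamma vrx mulrA ler_wpM2r ?invr_ge0 ?Gamma_fun_ge0//.
have ra : (r `^ a = r * r `^ (a - 1))%R.
  rewrite -[X in (_ = X * _)%R](powRr1 (ltW r0)).
  by rewrite -powRD ?(gt_eqF r0) ?implybT// addrC subrK.
rewrite powRM ?(ltW r0) ?(ltW x0)// mulrA -ra ler_peMl ?powR_ge0//.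
by rewrite -(powRr0 r) ler_powR.
Qed.

Lemma dirichlet_law_box n (a : R) (v : 'I_n.+1 -> R) : (forall j, 0 <= v j)%R ->
  dirichlet_law (fun _ => a)
    [set g : n.+1.-tuple R | forall j, v j < tnth g j]%R =
  (Gamma_fun (\sum_(j < n.+1) a))%:E *
    iter_conv (fun j => cut_gamma a (v j)) 1%R.
Proof.
move=> v0; rewrite -integral_Rn_prod ?Gamma_fun_ge0//; last 2 first.
- by move=> j x; exact: cut_gamma_ge0.
- by move=> j; exact: measurable_cut_gamma.
congr integral_Rn; apply/funext => x; congr EFin.
rewrite -/(simplex_point x) /dirichlet_pdf; set g := simplex_point x.
rewrite indicE; have [/set_mem/= vg|/negP vg] := boolP (g \in _).
  rewrite mulr1 ifT; last by apply/forallP => j; exact: le_lt_trans (vg j).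
  rewrite -mulrA; congr (_ * _)%R; rewrite -prodfV -big_split/=.
  by apply: eq_bigr => j _; rewrite /cut_gamma vg mulrC.
rewrite mulr0.
have [j vj] : exists j, ~~ (v j < tnth g j)%R.
  apply/existsP; rewrite -negb_forall; apply/negP => /forallP h.
  by apply: vg; apply/mem_set.
have zero : cut_gamma a (v j) (tnth g j) = 0%R by rewrite /cut_gamma ifN.
apply/esym/eqP; rewrite mulf_eq0; apply/orP; right.
by apply/prodf_eq0; exists j => //; exact/eqP.
Qed.

Lemma dirichlet_lawT n (a : R) :
  dirichlet_law (fun _ => a) [set: n.+1.-tuple R] =
  dirichlet_law (fun _ => a) [set g : n.+1.-tuple R | forall j, 0 < tnth g j]%R.
Proof.
congr integral_Rn; apply/funext => x; congr EFin.
rewrite /dirichlet_pdf; case: ifPn => [/forallP h|_]; last by rewrite !mul0r.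
by rewrite !indicE !mem_set.
Qed.

End dirichlet.

(** * Gamma integrals *)

Section gamma.
Context {R : realType}.
Local Notation mu := (@lebesgue_measure R).
Local Open Scope ereal_scope.

Lemma measurable_gamma_integrand (a : R) (D : set R) :
  measurable_fun D (fun x : R => (x `^ (a - 1) * expR (- x))%:E).
Proof.
suff m : measurable_fun [set: R] (fun x : R => (x `^ (a - 1) * expR (- x))%:E).
  exact: measurable_funTS m.
apply/measurable_EFinP/measurable_funM; first exact: measurable_powR.
exact: measurableT_comp.
Qed.

Lemma measurable_powRN1 (D : set R) :
  measurable_fun D (fun x : R => (x `^ (-1))%:E).
Proof.
suff m : measurable_fun [set: R] (fun x : R => (x `^ (-1))%:E).
  exact: measurable_funTS m.
by apply/measurable_EFinP; exact: measurable_powR.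
Qed.

Lemma gamma_integrand_ge0 (a x : R) : 0 <= (x `^ (a - 1) * expR (- x))%:E.
Proof. by rewrite lee_fin mulr_ge0 ?powR_ge0 ?expR_ge0. Qed.

(** Gamma_fun takes the finite part of the integral, which is 0 on +oo: a
    nonzero value certifies that the integral converges. *)
Lemma Gamma_funE (a : R) : Gamma_fun a != 0%R ->
  \int[mu]_(x in `]0%R, +oo[) (x `^ (a - 1) * expR (- x))%:E = (Gamma_fun a)%:E.
Proof.
rewrite /Gamma_fun /Rintegral; set I := \int[mu]_(x in _) _.
have I0 : 0 <= I by apply: integral_ge0 => x _; exact: gamma_integrand_ge0.
by case: I I0 => [r _ _|_|//]//=; rewrite eqxx.
Qed.

Lemma integral_cut_gamma (a v : R) :
  \int[mu]_x (expR (- x) * cut_gamma a v x)%:E =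
  (Gamma_fun a)^-1%:E *
    \int[mu]_(x in `]v, +oo[) (x `^ (a - 1) * expR (- x))%:E.
Proof.
rewrite -ge0_integralZl_EFin//; last 3 first.
- by move=> x _; exact: gamma_integrand_ge0.
- exact: measurable_gamma_integrand.
- by rewrite invr_ge0 Gamma_fun_ge0.
rewrite [RHS]integral_mkcond; apply: eq_integral => x _.
rewrite patchE /cut_gamma; case: ifPn => vx.
  rewrite ifT; last by rewrite inE/= in_itv/= andbT.
  by rewrite -EFinM; congr EFin; ring.
by rewrite mulr0 ifN// notin_setE/= in_itv/= andbT; apply/negP.
Qed.

Lemma integral_inv (u : R) : (0 < u < 1)%R ->
  \int[mu]_(x in `[u, 1%R]) (x `^ (-1))%:E = (- ln u)%:E.
Proof.
move=> /andP[u0 u1].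
have cln x : (0 < x)%R -> {for x, continuous (@ln R)} by exact: continuous_ln.
transitivity (\int[mu]_(x in `[u, 1%R]) (x^-1)%:E).
  apply: eq_integral => x /set_mem/=; rewrite in_itv/= => /andP[ux _].
  by rewrite powR_inv1// (le_trans (ltW u0)).
rewrite (@continuous_FTC2 _ _ (@ln R))//.
- by rewrite ln1 -EFinB sub0r.
- apply: continuous_in_subspaceT => x /set_mem/=.
  rewrite in_itv/= => /andP[ux _].
  by apply: continuousV; rewrite ?gt_eqF// (lt_le_trans u0).
- split.
  + move=> x; rewrite in_itv/= => /andP[ux _].
    by have [] := is_derive1_ln (lt_trans u0 ux).
  + by apply: cvg_at_right_filter; exact: cln.
  + by apply: cvg_at_left_filter; exact: cln.
- move=> x; rewrite in_itv/= => /andP[ux _].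
  by rewrite derive1E; have [_ ->] := is_derive1_ln (lt_trans u0 ux).
Qed.

(** The integrand is at most 1 / x on ]u, 1], and on ]1, +oo[ it grows with the
    exponent, which is a <= b: the bound is uniform as a tends to 0. *)
Lemma gamma_tail_le (a b u : R) : (0 <= a <= b)%R -> (0 < u < 1)%R ->
  Gamma_fun b != 0%R ->
  \int[mu]_(x in `]u, +oo[) (x `^ (a - 1) * expR (- x))%:E <=
  (- ln u + Gamma_fun b)%:E.
Proof.
move=> /andP[a0 ab] u01 Gb; have /andP[u0 u1] := u01.
have -> : `]u, +oo[%classic = `]u, 1%R] `|` `]1%R, +oo[ :> set R.
  by rewrite -itv_bndbnd_setU// bnd_simp ltW.
rewrite ge0_integral_setU//=; last 3 first.
- exact: measurable_gamma_integrand.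
- by move=> x _; exact: gamma_integrand_ge0.
- apply/disj_setPLR => x /=; rewrite !in_itv/= andbT => /andP[_ x1].
  by apply/negP; rewrite -leNgt.
rewrite EFinD -integral_inv// -Gamma_funE//; apply: leeD.
  apply: (@le_trans _ _ (\int[mu]_(x in `]u, 1%R]) (x `^ (-1))%:E)).
    apply: le_integral_nneg => [x _|x /=]; first exact: gamma_integrand_ge0.
    rewrite in_itv/= => /andP[ux x1].
    have x0 : (0 < x)%R by exact: lt_trans ux.
    rewrite lee_fin -[leRHS]mulr1 ler_pM ?powR_ge0 ?expR_ge0//.
      by rewrite ger_powR ?x0// lerBrDr addNr.
    by rewrite -[leRHS]expR0 ler_expR lerNl oppr0 ltW.
  apply: ge0_subset_integral => //.
  - exact: measurable_powRN1.
  - by move=> x _; rewrite lee_fin powR_ge0.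
  - by move=> x /=; rewrite !in_itv/= => /andP[/ltW -> ->].
apply: (@le_trans _ _
  (\int[mu]_(x in `]1%R, +oo[) (x `^ (b - 1) * expR (- x))%:E)).
  apply: le_integral_nneg => [x _|x /=]; first exact: gamma_integrand_ge0.
  rewrite in_itv/= andbT => x1; rewrite lee_fin ler_wpM2r ?expR_ge0//.
  by apply: ler_powR; [exact: ltW|rewrite lerD2r].
apply: ge0_subset_integral => //.
- exact: measurable_gamma_integrand.
- by move=> x _; exact: gamma_integrand_ge0.
- by move=> x /=; rewrite !in_itv/= !andbT; exact: lt_trans.
Qed.

(** Gamma(a) is of order 1 / a near 0: on [exp (- 1 / a), 1], both x^a and
    exp (- x) are at least exp (- 1), so the integrand is at least
    exp (- 2) / x. *)
Lemma Gamma_fun_ge (a : R) : (0 < a)%R -> Gamma_fun a != 0%R ->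
  (expR (- 2) / a <= Gamma_fun a)%R.
Proof.
move=> a0 Ga; rewrite -lee_fin -Gamma_funE//.
set v := expR (- a^-1).
have v0 : (0 < v)%R by exact: expR_gt0.
have v1 : (v < 1)%R by rewrite -[ltRHS]expR0 ltr_expR oppr_lt0 invr_gt0.
have -> : (expR (- 2) / a)%:E =
    (expR (- 2))%:E * \int[mu]_(x in `[v, 1%R]) (x `^ (-1))%:E.
  by rewrite integral_inv ?v0// /v expRK opprK.
rewrite -ge0_integralZl_EFin ?expR_ge0//; last 2 first.
- by move=> x _; rewrite lee_fin powR_ge0.
- exact: measurable_powRN1.
apply: (@le_trans _ _
  (\int[mu]_(x in `[v, 1%R]) (x `^ (a - 1) * expR (- x))%:E)).
  apply: le_integral_nneg => x /=; rewrite in_itv/= => /andP[vx x1].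
    by rewrite -EFinM lee_fin mulr_ge0 ?expR_ge0 ?powR_ge0.
  have x0 : (0 < x)%R by exact: lt_le_trans vx.
  rewrite -EFinM lee_fin.
  have -> : (x `^ (a - 1) = x `^ a * x `^ (-1))%R.
    by rewrite powRD ?(gt_eqF x0) ?implybT.
  have -> : (- 2 = - 1 + - 1 :> R)%R by ring.
  rewrite expRD [leRHS]mulrAC ler_wpM2r ?powR_ge0//.
  rewrite ler_pM ?expR_ge0//; last by rewrite ler_expR lerN2.
  have -> : (expR (- 1) = v `^ a)%R.
    by rewrite /v -expRM mulNr mulVf ?gt_eqF.
  by rewrite ge0_ler_powR// ?nnegrE ltW.
apply: ge0_subset_integral => //.
- exact: measurable_gamma_integrand.
- by move=> x _; exact: gamma_integrand_ge0.
- by move=> x /=; rewrite !in_itv/= andbT => /andP[vx _]; exact: lt_le_trans vx.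
Qed.

Lemma integral_cut_gamma_le (a b u : R) : (0 < a <= b)%R -> (0 < u < 1)%R ->
  Gamma_fun a != 0%R -> Gamma_fun b != 0%R ->
  \int[mu]_x (expR (- x) * cut_gamma a u x)%:E <=
  (a * expR 2 * (- ln u + Gamma_fun b))%:E.
Proof.
move=> /andP[a0 ab] /andP[u0 u1] Ga Gb.
have Ga_gt0 : (0 < Gamma_fun a)%R by rewrite lt_def Ga Gamma_fun_ge0.
have lnu : (0 <= - ln u)%R by rewrite oppr_ge0 ln_le0// ltW.
rewrite integral_cut_gamma EFinM; apply: lee_pmul.
- by rewrite lee_fin invr_ge0 ltW.
- by apply: integral_ge0 => x _; exact: gamma_integrand_ge0.
- rewrite lee_fin invf_ple ?posrE ?mulr_gt0 ?expR_gt0//.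
  by rewrite invfM -expRN mulrC Gamma_fun_ge.
- by apply: gamma_tail_le => //; rewrite ?u0 ?(ltW a0).
Qed.

Lemma integral_cut_gamma0 (a : R) : Gamma_fun a != 0%R ->
  \int[mu]_x (expR (- x) * cut_gamma a 0 x)%:E = 1.
Proof. by move=> Ga; rewrite integral_cut_gamma Gamma_funE// -EFinM mulVf. Qed.

(** The total mass 1 forces both Gamma values in the normalization to be
    nonzero, hence both Gamma integrals to converge. *)
Lemma dirichlet_tail_le n (a b u : R) (S : {set 'I_n.+1}) :
  (0 < a)%R -> (0 < u < 1)%R ->
  dirichlet_law (fun _ => a) [set: n.+1.-tuple R] = 1 ->
  (\sum_(j < n.+1) a)%R = b ->
  dirichlet_law (fun _ => a)
    [set g : n.+1.-tuple R |
       forall j, (if j \in S then u else 0) < tnth g j]%R <=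
  (2 * expR 2 * Gamma_fun b *
     (a * expR 2 * (- ln u + Gamma_fun b)) ^+ #|S|)%:E.
Proof.
move=> a0 u01 mass1 sumE; pose G := Gamma_fun b; have /andP[u0 u1] := u01.
have lnu : (0 <= - ln u)%R by rewrite oppr_ge0 ln_le0// ltW.
have G0 : (0 <= G)%R by exact: Gamma_fun_ge0.
have aG : (a <= b)%R.
  by rewrite -sumE big_ord_recl lerDl sumr_ge0// => *; exact: ltW.
have GN0 : G != 0%R.
  apply/eqP => GE; move: mass1.
  rewrite dirichlet_lawT dirichlet_law_box// sumE -/G GE mul0e.
  by move/eqP; rewrite eq_sym onee_eq0.
have GaN0 : Gamma_fun a != 0%R.
  apply/eqP => GE; move: mass1; rewrite dirichlet_lawT dirichlet_law_box//.
  suff -> : iter_conv (fun _ : 'I_n.+1 => cut_gamma a 0) 1%R = 0.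
    by rewrite mule0 => /eqP; rewrite eq_sym onee_eq0.
  have cut0 : cut_gamma a 0 = fun=> 0%R.
    by apply/funext => x; rewrite /cut_gamma GE invr0 mulr0 if_same.
  rewrite cut0; case: n {S sumE} => [//|n] /=.
  by apply: integral0_eq => x _; rewrite mul0e.
rewrite dirichlet_law_box; last by move=> j; case: ifP => // _; exact: ltW.
rewrite sumE -/G; set q := (a * expR 2 * _)%R.
have -> : (2 * expR 2 * G * q ^+ #|S| = G * (2 * expR 2 * q ^+ #|S|))%R by ring.
rewrite EFinM; apply: lee_wpmul2l; first by rewrite lee_fin.
apply: le_trans (iter_conv1_le _ _ _) _.
- by move=> j x; exact: cut_gamma_ge0.
- by move=> j; exact: measurable_cut_gamma.
- move=> r r1 j x; apply: cut_gamma_scale => //; first exact: ltW.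
  by case: ifP => // _; exact: ltW.
rewrite [leRHS]EFinM; apply: lee_wpmul2l.
  by rewrite lee_fin mulr_ge0 ?expR_ge0.
have -> : (q ^+ #|S|)%:E = \prod_(j < n.+1) (if j \in S then q else 1%R)%:E.
  by rewrite prodEFin; congr EFin; rewrite -big_mkcond/= prodr_const.
apply: lee_prod_nneg => j; apply/andP; split.
  apply: integral_ge0 => x _.
  by rewrite lee_fin mulr_ge0 ?expR_ge0 ?cut_gamma_ge0.
case: ifP => _; last by rewrite integral_cut_gamma0.
by apply: integral_cut_gamma_le; rewrite ?a0.
Qed.

End gamma.

(** * Exponential and Laplace tails *)

Section laplace.
Context {R : realType}.
Local Notation mu := (@lebesgue_measure R).
Local Open Scope ereal_scope.

Lemma exponential_prob_setC (r t : R) : (0 < r)%R -> (0 < t)%R ->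
  exponential_prob r (~` `]0%R, t]) = (expR (- (r * t)))%:E.
Proof.
move=> r0 t0; have := integral_exponential_pdf r0.
have mE D : measurable_fun D (EFin \o exponential_pdf r).
  suff m : measurable_fun [set: R] (EFin \o exponential_pdf r).
    exact: measurable_funTS m.
  by apply/measurable_EFinP; exact: measurable_exponential_pdf.
rewrite -(setUv `]0%R, t]%classic) ge0_integral_setU//=; last 4 first.
- exact: measurableC.
- by rewrite setUv; exact: mE.
- by move=> x _; rewrite lee_fin exponential_pdf_ge0// ltW.
- exact/disj_setPCl.
rewrite (@integral_itv_obnd_cbnd _ _ _ (EFin \o exponential_pdf r));
  last exact: mE.
rewrite [X in X + _ = _ -> _](exponential_prob_itv0c r t0).
rewrite -/(exponential_prob r _) mulNr -EFinB.
case: exponential_prob => [x| |]//=.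
by rewrite -EFinD => -[E]; congr EFin; lra.
Qed.

Lemma exponential_prob_le (r : R) (A B : set R) : (0 <= r)%R ->
  measurable A -> measurable B -> A `<=` B ->
  exponential_prob r A <= exponential_prob r B.
Proof.
move=> r0 mA mB AB; apply: ge0_subset_integral => //.
- suff m : measurable_fun [set: R] (EFin \o exponential_pdf r).
    exact: measurable_funTS m.
  by apply/measurable_EFinP; exact: measurable_exponential_pdf.
- by move=> x _; rewrite lee_fin exponential_pdf_ge0.
Qed.

(** Away from 0, the Laplace density is the average of the exponential density and
    of its reflection. *)
Lemma laplace_law_le_exponential (psi : R) (E : set R) : (0 < psi)%R ->
  measurable E -> (forall x, E x -> E (- x)%R) ->
  laplace_law psi E <= exponential_prob psi^-1 E.
Proof.
move=> psi0 mE sE; pose h := (exponential_pdf psi^-1) \_ E.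
have ipsi : (0 <= psi^-1)%R by rewrite invr_ge0 ltW.
have h0 x : (0 <= h x)%R.
  by apply: restrict_ge0 => y _; exact: exponential_pdf_ge0.
have mh : measurable_fun [set: R] h.
  apply/(measurable_restrictT _ mE); apply: measurable_funTS.
  exact: measurable_exponential_pdf.
have mhN : measurable_fun [set: R] (fun x => h (- x)%R).
  by apply: measurableT_comp.
have hE : \int[mu]_x (h x)%:E = exponential_prob psi^-1 E.
  rewrite /exponential_prob [RHS]integral_mkcond.
  by apply: eq_integral => x _; rewrite /h !patchE; case: ifP.
have hNE : \int[mu]_x (h (- x)%R)%:E = \int[mu]_x (h x)%:E.
  rewrite [RHS](@integral_affine _ (- 1) 0) ?oppr_eq0 ?oner_eq0//;
    last exact/measurable_EFinP.
  by rewrite normrN1 mul1e; apply: eq_integral => x _; rewrite addr0 mulN1r.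
apply: (@le_trans _ _ (\int[mu]_x (2^-1%:E * ((h x)%:E + (h (- x)%R)%:E))));
  last first.
  rewrite ge0_integralZl_EFin//; last 2 first.
  - by move=> x _; rewrite -EFinD lee_fin addr_ge0.
  - by apply: emeasurable_funD; exact/measurable_EFinP.
  rewrite ge0_integralD//; last 4 first.
  - by move=> x _; rewrite lee_fin.
  - exact/measurable_EFinP.
  - by move=> x _; rewrite lee_fin.
  - exact/measurable_EFinP.
  rewrite hNE hE; have : 0 <= exponential_prob psi^-1 E.
    by apply: integral_ge0 => x _; rewrite lee_fin exponential_pdf_ge0.
  case: (exponential_prob psi^-1 E) => [e _|_|//]; last by rewrite leey.
  by rewrite -EFinD -EFinM lee_fin; lra.
rewrite /laplace_law integral_mkcond; apply: le_integral_nneg => x _.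
  apply: erestrict_ge0 => y _.
  by rewrite lee_fin mulr_ge0 ?expR_ge0// invr_ge0 mulr_ge0// ltW.
rewrite patchE; case: ifPn => [Ex|_]; last first.
  by rewrite -EFinD -EFinM lee_fin mulr_ge0 ?invr_ge0 ?addr_ge0.
have ENx : (- x)%R \in E by apply/mem_set/sE/set_mem.
rewrite -EFinD -EFinM lee_fin /h !patchE Ex ENx.
rewrite /laplace_pdf invfM -mulrA ler_wpM2l ?invr_ge0//.
have [x0|x0] := leP 0%R x.
  rewrite ger0_norm// [x in (_ <= x + _)%R]exponential_pdfE//.
  rewrite mulNr [(x / _)%R]mulrC.
  by rewrite lerDl exponential_pdf_ge0.
rewrite ltr0_norm// [x in (_ <= _ + x)%R]exponential_pdfE ?oppr_ge0 ?(ltW x0)//.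
rewrite (_ : - (- x / psi) = - psi^-1 * - x)%R; last by ring.
by rewrite lerDr exponential_pdf_ge0.
Qed.

Lemma measurable_norm_gt (delta : R) : measurable [set x : R | delta < `|x|]%R.
Proof.
rewrite (_ : [set _ | _] = `]delta, +oo[ `|` `]-oo, (- delta)%R[).
  exact: measurableU.
apply/seteqP; split => x /=; rewrite !in_itv/= andbT ltr_normr ltrNr.
  by move/orP.
by move=> ?; apply/orP.
Qed.

Lemma laplace_law_tail_le (psi delta : R) : (0 < psi)%R -> (0 < delta)%R ->
  laplace_law psi [set x | delta < `|x|]%R <= (expR (- (delta / psi)))%:E.
Proof.
move=> psi0 delta0; apply: le_trans (laplace_law_le_exponential psi0 _ _) _.
- exact: measurable_norm_gt.
- by move=> x /=; rewrite normrN.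
- rewrite mulrC -exponential_prob_setC ?invr_gt0//; apply: exponential_prob_le.
  + by rewrite invr_ge0 ltW.
  + exact: measurable_norm_gt.
  + exact: measurableC.
  + move=> x /= dx; rewrite in_itv/= => /andP[x0 xd].
    by move: dx; rewrite gtr0_norm// ltNge xd.
Qed.

Lemma laplace_lawT_le1 (psi : R) : (0 < psi)%R -> laplace_law psi setT <= 1.
Proof.
move=> psi0.
apply: le_trans (laplace_law_le_exponential psi0 measurableT _) _ => //.
by rewrite /exponential_prob integral_exponential_pdf// invr_gt0.
Qed.

Lemma laplace_law_ge0 (psi : R) (E : set R) :
  (0 <= psi)%R -> 0 <= laplace_law psi E.
Proof.
move=> psi0; apply: integral_ge0 => x _.
by rewrite lee_fin mulr_ge0 ?expR_ge0// invr_ge0 mulr_ge0.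
Qed.

End laplace.

(** * Union bound for the cardinality of a random set *)

Section union_bound.
Context d (T : measurableType d) (R : realType).
Local Open Scope ereal_scope.

Lemma measurable_forall_ord n (F : 'I_n -> set T) :
  (forall j, measurable (F j)) -> measurable [set w | forall j, F j w].
Proof.
move=> mF; rewrite (_ : [set _ | _] = \bigcap_(j in [set: 'I_n]) F j).
  by apply: fin_bigcap_measurable => //; exact: finite_finset.
by apply/seteqP; split => w /= h j; [move=> _; exact: h|exact: h].
Qed.

Lemma measure_bigsetU_le (P : {measure set T -> \bar R}) (I : finType)
    (Q : pred I) (F : I -> set T) :
  (forall i, Q i -> measurable (F i)) ->
  P (\big[setU/set0]_(i | Q i) F i) <= \sum_(i | Q i) P (F i).
Proof.
move=> mF.
suff [] : measurable (\big[setU/set0]_(i | Q i) F i) /\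
    P (\big[setU/set0]_(i | Q i) F i) <= \sum_(i | Q i) P (F i) by [].
elim/big_rec2 : _ => [|i y A Qi [mA le]]; first by rewrite measure0.
split; first by apply: measurableU => //; exact: mF.
by apply: le_trans (measureU2 _ _ _) _ => //; [exact: mF|exact: leeD].
Qed.

Lemma card_ge_bigsetU p k (G : set T) (Z : T -> {set 'I_p}) :
  G `&` [set w | (k <= #|Z w|)%N] =
  \big[setU/set0]_(S : {set 'I_p} | #|S| == k) (G `&` [set w | S \subset Z w]).
Proof.
rewrite -(bigcup_pred (fun S : {set 'I_p} => #|S| == k)).
apply/seteqP; split => w /=; last first.
  by move=> [S /eqP <-] [Gw SZ]; split => //; exact: subset_leq_card.
move=> [Gw /card_geqP [s [us <- sZ]]].
exists [set x in s]%SET => /=.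
  by rewrite unfold_in cardsE; apply/eqP/card_uniqP.
by split => //; apply/fintype.subsetP => x; rewrite inE; exact: sZ.
Qed.

Lemma measurable_card_ge p k (G : set T) (Z : T -> {set 'I_p}) :
  (forall S : {set 'I_p}, measurable (G `&` [set w | S \subset Z w])) ->
  measurable (G `&` [set w | (k <= #|Z w|)%N]).
Proof.
by move=> mZ; rewrite card_ge_bigsetU; apply: bigsetU_measurable.
Qed.

Lemma measure_card_ge_le (P : {measure set T -> \bar R}) p k (G : set T)
    (Z : T -> {set 'I_p}) (b : R) :
  (forall S : {set 'I_p}, measurable (G `&` [set w | S \subset Z w])) ->
  (forall S : {set 'I_p}, #|S| = k ->
     P (G `&` [set w | S \subset Z w]) <= b%:E) ->
  P (G `&` [set w | (k <= #|Z w|)%N]) <= ('C(p, k)%:R * b)%:E.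
Proof.
move=> mZ Pb; rewrite card_ge_bigsetU.
apply: le_trans (measure_bigsetU_le _ _) _ => //.
apply: (@le_trans _ _ (\sum_(S : {set 'I_p} | #|S| == k) b%:E)).
  by apply: lee_sum => S /eqP; exact: Pb.
rewrite sumEFin lee_fin sumr_const mulr_natl.
have <- : #|[set S : {set 'I_p} | #|S| == k]%SET| = 'C(p, k).
  by rewrite card_draws card_ord.
by rewrite cardsE.
Qed.

End union_bound.

(** * Large coordinates under the shrinkage prior *)

Section shrinkage.
Context {R : realType} (alpha : R) (n : nat) (d : measure_display)
    (T : measurableType d) (P : probability T R) (tau : {RV P >-> R})
    (gamma theta : {RV P >-> n.+1.-tuple R}).
Context (alpha0 : 0 < alpha)
    (prior : is_shrinkage_prior alpha tau gamma theta).

Let mtau (D : set R) : measurable D -> measurable (tau @^-1` D).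
Proof.
by move=> mD; rewrite -[X in measurable X]setTI; exact: measurable_funP.
Qed.

Let mtnth (D : set R) (f : {RV P >-> n.+1.-tuple R}) j : measurable D ->
  measurable [set w | D (tnth (f w) j)].
Proof.
move=> mD; rewrite -[X in measurable X]setTI.
have m : measurable_fun [set: T] (fun w => tnth (f w) j).
  by apply: (measurableT_comp (measurable_tnth j)).
exact: m.
Qed.

Let measurable_gt (v : 'I_n.+1 -> R) :
  measurable [set w | forall j, v j < tnth (gamma w) j].
Proof.
apply: (@measurable_forall_ord _ _ _
  (fun j => [set w | v j < tnth (gamma w) j])) => j.
rewrite (_ : [set _ | _] = [set w | `](v j), +oo[%classic (tnth (gamma w) j)]).
  exact: mtnth.
by apply/seteqP; split => w /=; rewrite in_itv/= andbT.
Qed.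

Lemma tau_tail (t : R) : 0 < t ->
  P (tau @^-1` (~` `]0, t])) = (expR (- (t / 2)))%:E.
Proof.
move=> t0; have [+ _ _ _] := prior; move=> /(_ (~` `]0, t])).
rewrite /distribution /pushforward => -> //; last exact: measurableC.
by rewrite exponential_prob_setC// mulrC.
Qed.

Let a := alpha / n.+1%:R.

Lemma gamma_box (v : 'I_n.+1 -> R) :
  P [set w | forall j, v j < tnth (gamma w) j] =
  dirichlet_law (fun _ => a) [set g : n.+1.-tuple R | forall j, v j < tnth g j].
Proof.
have [_ + _ _] := prior.
move=> <-//; apply: (@measurable_forall_ord _ _ _
  (fun j => [set g : n.+1.-tuple R | v j < tnth g j])) => j.
rewrite (_ : [set _ | _] =
  (fun g : n.+1.-tuple R => tnth g j) @^-1` `](v j), +oo[); last first.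
  by apply/seteqP; split => x /=; rewrite in_itv/= andbT.
by rewrite -[X in measurable X]setTI; exact: measurable_tnth.
Qed.

Lemma dirichlet_mass1 : dirichlet_law (fun _ : 'I_n.+1 => a) setT = 1%E.
Proof.
have [_ /(_ setT measurableT) <- _ _] := prior.
by rewrite /distribution /pushforward preimage_setT probability_setT.
Qed.

Let positive : set T := [set w | forall j, 0 < tnth (gamma w) j].

Lemma positive_ae : P (~` positive) = 0%E.
Proof.
rewrite probability_setC; last exact: (measurable_gt (fun=> 0)).
rewrite /positive (gamma_box (fun _ => 0)) -dirichlet_lawT dirichlet_mass1.
by rewrite subee.
Qed.

Let heavy (u : R) (w : T) : {set 'I_n.+1} := [set j | u < tnth (gamma w) j]%SET.
Let Gam := Gamma_fun alpha.

Let heavyE (u : R) (S : {set 'I_n.+1}) : 0 <= u ->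
  positive `&` [set w | S \subset heavy u w] =
  [set w | forall j, (if j \in S then u else 0) < tnth (gamma w) j].
Proof.
move=> u0; apply/seteqP; split => w /=.
  move=> [pw /fintype.subsetP Sw] j; case: ifP => // jS.
  by have := Sw _ jS; rewrite inE.
move=> h; split=> [j|].
  by apply: le_lt_trans (h j); case: ifP.
by apply/fintype.subsetP => j jS; rewrite inE; have := h j; rewrite jS.
Qed.

Lemma heavy_count (u : R) k : 0 < u < 1 ->
  (P (positive `&` [set w | (k <= #|heavy u w|)%N]) <=
   ('C(n.+1, k)%:R *
    (2 * expR 2 * Gam * (a * expR 2 * (- ln u + Gam)) ^+ k))%:E)%E.
Proof.
move=> u01; have /andP[u0 _] := u01.
apply: measure_card_ge_le => S; first by rewrite heavyE ?(ltW u0).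
move=> <-; rewrite heavyE ?(ltW u0)//.
rewrite [leLHS](gamma_box (fun j => if j \in S then u else 0)).
apply: dirichlet_tail_le => //.
- by rewrite divr_gt0.
- exact: dirichlet_mass1.
- by rewrite sumr_const card_ord -mulr_natr divfK.
Qed.

Let light (u delta : R) (w : T) : {set 'I_n.+1} :=
  [set j | (tnth (gamma w) j <= u) && (delta < `|tnth (theta w) j|)]%SET.

(** The constraints on (tau, gamma) and, in B below, on theta that make every
    coordinate of S light and large: a box on which the conditional law of theta
    is prescribed. *)
Let D (u t : R) (S : {set 'I_n.+1}) : set (R * n.+1.-tuple R) :=
  [set x | 0 < x.1 <= t /\
           forall j, 0 < tnth x.2 j /\ (j \in S -> tnth x.2 j <= u)].

Let B (delta : R) (S : {set 'I_n.+1}) j : set R :=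
  if j \in S then [set x | delta < `|x|] else setT.

Let window (t : R) : set T := positive `&` (tau @^-1` `]0, t]).

Let lightE (u delta t : R) (S : {set 'I_n.+1}) :
  window t `&` [set w | S \subset light u delta w] =
  [set w | D u t S (tau w, gamma w) /\
           forall j, B delta S j (tnth (theta w) j)].
Proof.
apply/seteqP; split => w /=; rewrite /window /= ?in_itv/=.
  move=> [[pw tw] /fintype.subsetP Sw]; split; first split=> //= j.
    by split=> // jS; have := Sw _ jS; rewrite inE => /andP[].
  move=> j; rewrite /B; case: ifP => // jS.
  by have := Sw _ jS; rewrite inE => /andP[].
move=> [[/= tw h] hB]; split; first by split=> // j; have [] := h j.
apply/fintype.subsetP => j jS; rewrite inE; have [_ /(_ jS) ->] := h j.
by have := hB j; rewrite /B jS.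
Qed.

Let measurable_D (u t : R) (S : {set 'I_n.+1}) : measurable (D u t S).
Proof.
pose I j : set R := if j \in S then `]0, u]%classic else `]0, +oo[%classic.
rewrite (_ : D u t S = fst @^-1` `]0, t] `&`
    [set x | forall j, I j (tnth x.2 j)]).
  apply: measurableI.
    by rewrite -[X in measurable X]setTI; exact: measurable_fst.
  apply: (@measurable_forall_ord _ _ _
    (fun j => [set x : R * n.+1.-tuple R | I j (tnth x.2 j)])) => j.
  have mI : measurable (I j) by rewrite /I; case: ifP.
  have m : measurable_fun setT (fun x : R * n.+1.-tuple R => tnth x.2 j).
    exact: (measurableT_comp (measurable_tnth j)).
  by rewrite -[X in measurable X]setTI; exact: m.
apply/seteqP; split => x /=; rewrite ?in_itv/= => -[xt h];
  (split; first by rewrite ?in_itv) => j.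
  have [g0 gu] := h j.
  by rewrite /I; case: ifP => jS; rewrite /= in_itv/= g0 ?gu.
have := h j; rewrite /I.
case: ifP => jS; rewrite /= in_itv/= ?andbT; last by [].
by move=> /andP[-> ->].
Qed.

Let measurable_B (delta : R) (S : {set 'I_n.+1}) j : measurable (B delta S j).
Proof. by rewrite /B; case: ifP => // _; exact: measurable_norm_gt. Qed.

Let measurable_light (u delta t : R) (S : {set 'I_n.+1}) : measurable
  (window t `&` [set w | S \subset light u delta w]).
Proof.
rewrite lightE; apply: measurableI; last first.
  by apply: measurable_forall_ord => j; exact: mtnth.
have m : measurable_fun [set: T] (fun w => (tau w, gamma w)).
  exact: measurable_fun_pair.
by rewrite -[X in measurable X]setTI; exact: m.
Qed.

Lemma light_count (u delta t : R) k : 0 < u -> 0 < delta -> 0 < t ->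
  (P (window t `&` [set w | (k <= #|light u delta w|)%N]) <=
   ('C(n.+1, k)%:R * expR (- (delta / (t * u))) ^+ k)%:E)%E.
Proof.
move=> u0 delta0 t0; apply: measure_card_ge_le => S.
  exact: measurable_light.
move=> cS; rewrite lightE; have [_ _ _ cond] := prior.
rewrite [leLHS](cond (D u t S) (B delta S))//.
have mDw : measurable [set w | D u t S (tau w, gamma w)].
  have m : measurable_fun [set: T] (fun w => (tau w, gamma w)).
    exact: measurable_fun_pair.
  by rewrite -[X in measurable X]setTI; exact: m.
set e := expR _.
apply: (@le_trans _ _ (\int[P]_(w in [set w | D u t S (tau w, gamma w)])
                          (cst (e ^+ k)%:E) w)%E).
  apply: le_integral_nneg => w [/= /andP[tw tt] h].
    apply: prode_ge0 => j _; apply: laplace_law_ge0.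
    by have [/ltW ? _] := h j; rewrite mulr_ge0// ltW.
  have -> : (e ^+ k)%:E = (\prod_(j < n.+1) (if j \in S then e else 1%R)%:E)%E.
    by rewrite prodEFin; congr EFin; rewrite -big_mkcond/= prodr_const cS.
  apply: lee_prod_nneg => j; have [g0 gu] := h j.
  have tg0 : 0 < tau w * tnth (gamma w) j by exact: mulr_gt0.
  rewrite laplace_law_ge0 ?(ltW tg0)//= /B.
  case: ifP => jS; last exact: laplace_lawT_le1.
  apply: le_trans (laplace_law_tail_le tg0 delta0) _.
  rewrite lee_fin ler_expR lerN2 ler_pM2l// lef_pV2 ?posrE ?mulr_gt0//.
  by apply: ler_pM => //; [exact: ltW|exact: ltW|exact: gu].
rewrite integral_cst//= -[leRHS]mule1; apply: lee_wpmul2l.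
  by rewrite lee_fin exprn_ge0 ?expR_ge0.
exact: probability_le1.
Qed.

Lemma measurable_supp (delta : R) k :
  measurable [set w | (k <= #|supp_gt delta (theta w)|)%N].
Proof.
rewrite -[X in measurable X]setTI.
apply: measurable_card_ge => S; rewrite setTI.
rewrite (_ : [set _ | _] = [set w | forall j, B delta S j (tnth (theta w) j)]).
  by apply: measurable_forall_ord => j; exact: mtnth.
apply/seteqP; split => w /=.
  move=> /fintype.subsetP Sw j; rewrite /B; case: ifP => // jS.
  by have := Sw _ jS; rewrite inE.
move=> h; apply/fintype.subsetP => j jS; rewrite inE.
by have := h j; rewrite /B jS.
Qed.

(** The three terms bound a large tau, k + 1 heavy coordinates, and k + 1
    coordinates that are large with a light weight. *)
Lemma supp_tail (u delta t : R) k : 0 < u < 1 -> 0 < delta -> 0 < t ->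
  (P [set w | (k.*2 < #|supp_gt delta (theta w)|)%N] <=
   (expR (- (t / 2)) +
    'C(n.+1, k.+1)%:R *
      (2 * expR 2 * Gam * (a * expR 2 * (- ln u + Gam)) ^+ k.+1) +
    'C(n.+1, k.+1)%:R * expR (- (delta / (t * u))) ^+ k.+1)%:E)%E.
Proof.
move=> u01 delta0 t0; have /andP[u0 _] := u01.
set E1 := tau @^-1` (~` `]0, t]).
have mE1 : measurable E1 by apply: mtau; exact: measurableC.
have mE2 : measurable (~` positive) by apply: measurableC; exact: measurable_gt.
set E3 := positive `&` [set w | (k < #|heavy u w|)%N].
have mE3 : measurable E3.
  by apply: measurable_card_ge => S; rewrite heavyE ?(ltW u0).
set E4 := window t `&` [set w | (k < #|light u delta w|)%N].
have mE4 : measurable E4.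
  by apply: measurable_card_ge => S; exact: measurable_light.
apply: (@le_trans _ _ (P ((E1 `|` ~` positive) `|` E3 `|` E4))).
  apply: le_measure; rewrite ?inE; first exact: measurable_supp.
    by do !apply: measurableU.
  move=> w /= kw.
  have [pw|npw] := pselect (positive w); last by left; left; right.
  have [tw|ntw] := pselect (`]0, t]%classic (tau w)); last by left; left; left.
  have : (k.*2 < #|heavy u w| + #|light u delta w|)%N.
    apply: leq_trans kw _; apply: leq_trans (leq_card_setU _ _).
    apply: subset_leq_card; apply/fintype.subsetP => j; rewrite !inE => dj.
    by rewrite dj andbT; case: ltP.
  have [kh _|hk] := ltnP k #|heavy u w|; first by left; right.
  rewrite -addnn => kk; right; split => //=.
  by rewrite -(ltn_add2l k); apply: leq_trans kk _; rewrite leq_add2r.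
rewrite 2!EFinD -tau_tail//.
apply: le_trans (measureU2 _ _ _) _ => //; first by do !apply: measurableU.
apply: leeD; last exact: light_count.
apply: le_trans (measureU2 _ _ _) _ => //; first exact: measurableU.
apply: leeD; last exact: heavy_count.
apply: le_trans (measureU2 _ _ _) _ => //.
by rewrite [X in (_ + X <= _)%E]positive_ae adde0.
Qed.

End shrinkage.

(** * Choice of the constants *)

Section numeric.
Context {R : realType}.
Implicit Types (q lambda : R).

(** 'C(p, m) q^m <= lambda^m / m! = exp (- m) (e lambda)^m / m!, and the last
    factor is a term of the series of exp (e lambda). *)
Lemma bin_pow_le (p k : nat) q lambda : 0 <= q -> p%:R * q <= lambda ->
  'C(p, k.+1)%:R * q ^+ k.+1 <= expR (expR 1 * lambda - k.+1%:R).
Proof.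
move=> q0 pq; have lambda0 : 0 <= lambda.
  by apply: le_trans pq; rewrite mulr_ge0.
set m := k.+1; have f0 : 0 < m`!%:R :> R by rewrite ltr0n fact_gt0.
have binle : 'C(p, m)%:R <= p%:R ^+ m / m`!%:R :> R.
  rewrite ler_pdivlMr// -natrM bin_ffact -natrX ler_nat {f0}.
  by elim: m => // m IH; rewrite ffactnSr expnSr leq_mul// leq_subr.
apply: (@le_trans _ _ (lambda ^+ m / m`!%:R)).
  apply: le_trans (ler_wpM2r (exprn_ge0 m q0) binle) _.
  by rewrite mulrAC -exprMn ler_pM2r ?invr_gt0// lerXn2r ?nnegrE ?mulr_ge0.
rewrite expRD; have -> : lambda ^+ m / m`!%:R =
    (expR 1 * lambda) ^+ m / m`!%:R * expR (- m%:R).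
  rewrite exprMn -expRM_natl mulr1 expRN; field.
  by rewrite !gt_eqF ?expR_gt0.
rewrite ler_wpM2r ?expR_ge0//.
apply: le_trans _ (expR_ge1Dxn k (mulr_ge0 (expR_ge0 1) lambda0)).
by rewrite lerDr.
Qed.

End numeric.

(** With k = truncn (A s / 2), each of the three terms of supp_tail is at most a
    constant times exp (- L s), where L exceeds C enough to absorb the
    constants. *)
Lemma supp_tail_bound_ge (R : realType) (alpha B c C : R) :
  0 < alpha -> 0 < B -> 0 < c -> 0 < C ->
  exists A0 : R, 0 < A0 /\
    forall A : R, A0 <= A -> supp_tail_bound alpha B c A C.
Proof.
move=> alpha0 B0 c0 C0.
have ln2 : 0 < ln 2 :> R by rewrite ln_gt0// ltr1n.
pose Gam : R := Gamma_fun alpha; have Gam0 : 0 <= Gam by exact: Gamma_fun_ge0.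
pose K : R := 2 * expR 2 * Gam.
have K0 : 0 <= K by rewrite !mulr_ge0 ?expR_ge0.
(* exp (M s) absorbs the constant 3 (K + 1), since s >= c ln 2 *)
pose M : R := 3 * (K + 1) / (c * ln 2).
have M0 : 0 < M by rewrite divr_gt0 ?mulr_gt0//; lra.
pose L : R := C + M + 1.
have L1 : 1 < L by rewrite /L; lra.
(* E ln p bounds 1 and p q, where q bounds the probability to be heavy *)
pose E : R := expR 2 * alpha * (B + 3 + (ln (2 * L) + Gam) / ln 2) + (ln 2)^-1.
have E0 : (ln 2)^-1 <= E.
  rewrite lerDr !mulr_ge0 ?expR_ge0 ?(ltW alpha0)//.
  rewrite addr_ge0 ?divr_ge0 ?addr_ge0 ?(ltW ln2)//.
    exact: ltW.
  by rewrite ln_ge0//; lra.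
have E1 : 0 < E by apply: lt_le_trans E0; rewrite invr_gt0.
have eE0 : 0 < expR 1 * E / c by rewrite !mulr_gt0 ?expR_gt0 ?invr_gt0.
exists (2 * (expR 1 * E / c + L)); split; first lra.
move=> A A0 n eps s d T P tau gamma theta prior /andP[eps0 eps1] epsB cs.
(* for p = 1 the conditions on eps are contradictory *)
have n0 : (0 < n)%N.
  case: n cs epsB {gamma theta prior} => // _.
  by rewrite powR1 invr1 => /(lt_trans eps1); rewrite ltxx.
set p : R := n.+1%:R in epsB cs *.
have p2 : 2 <= p by rewrite ler_nat ltnS.
have p0 : 0 < p by lra.
have lnp : ln 2 <= ln p by rewrite ler_ln ?posrE.
have lnp0 : 0 < ln p by exact: lt_le_trans lnp.
have s0 : 0 < s by apply: lt_le_trans cs; exact: mulr_gt0.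
have A1 : 1 <= A by lra.
have [Asp|pAs] := ltP (A * s) p; last first.
  rewrite [X in P X](_ : _ = set0) ?measure0 ?lee_fin ?expR_ge0//.
  apply/seteqP; split=> // w /=; apply/negP; rewrite -leNgt.
  apply: le_trans pAs; rewrite ler_nat; apply: leq_trans (max_card _) _.
  by rewrite card_ord.
have sp : s <= p by apply: le_trans (ltW Asp); rewrite ler_peMl// ltW.
(* with t = 2 L p below, this makes delta / (t u) = eps p^(B + 1) >= p *)
pose u := p `^ (- (B + 3)) / (2 * L).
have pB0 : 0 < p `^ (- (B + 3)) by rewrite powR_gt0.
have u0 : 0 < u by rewrite divr_gt0//; lra.
have lnuE : - ln u = (B + 3) * ln p + ln (2 * L).
  rewrite /u ln_div ?posrE//; last by lra.
  by rewrite ln_powR; ring.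
have ln2L : 0 < ln (2 * L) by rewrite ln_gt0//; lra.
have u1 : u < 1.
  have : ln u < ln 1 by rewrite ln1 -oppr_gt0 lnuE addr_gt0// mulr_gt0//; lra.
  by rewrite ltr_ln ?posrE.
have As0 : 0 <= A * s by rewrite mulr_ge0; lra.
pose k := Num.truncn (A * s / 2).
have As2 : 0 <= A * s / 2 by rewrite divr_ge0// mulr_ge0; lra.
have kle : k%:R <= A * s / 2 by rewrite truncn_le.
have kgt : A * s / 2 < k.+1%:R by exact: truncnS_gt.
pose t := 2 * L * p.
have t0 : 0 < t by rewrite mulr_gt0//; lra.
have delta0 : 0 < eps / p by exact: divr_gt0.
have expo x : x <= E * ln p -> expR 1 * x - k.+1%:R <= - (L * s).
  move=> xE.
  have : expR 1 * x <= expR 1 * E / c * s.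
    have -> : expR 1 * E / c * s = expR 1 * E * (s / c) by ring.
    rewrite -mulrA ler_pM2l ?expR_gt0//; apply: le_trans xE _.
    by rewrite ler_pM2l// ler_pdivlMr// mulrC.
  have : (expR 1 * E / c + L) * s <= A / 2 * s by rewrite ler_pM2r//; lra.
  lra.
apply: (@le_trans _ _ (P [set w | (k.*2 < #|supp_gt (eps / p) (theta w)|)%N])).
  apply: le_measure; rewrite ?inE.
  - rewrite (_ : [set _ | _] =
      [set w | (Num.truncn (A * s) < #|supp_gt (eps / p) (theta w)|)%N]).
      exact: measurable_supp.
    by apply/seteqP; split => w /=; rewrite truncn_lt_nat.
  - exact: measurable_supp.
  - move=> w /= Asw; rewrite -(ltr_nat R) -muln2 natrM; apply: le_lt_trans Asw.
    by rewrite -ler_pdivlMr.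
have u01 : 0 < u < 1 by rewrite u0.
apply: le_trans (supp_tail alpha0 prior k u01 delta0 t0) _.
rewrite lee_fin -/Gam -/K -/p.
have T1 : expR (- (t / 2)) <= expR (- (L * s)).
  rewrite ler_expR lerN2 /t.
  have -> : 2 * L * p / 2 = L * p by field.
  by rewrite ler_pM2l//; lra.
set q := alpha / p * expR 2 * (- ln u + Gam).
have q0 : 0 <= q.
  have lnu0 : 0 <= - ln u by rewrite oppr_ge0 ln_le0// ltW.
  apply: mulr_ge0; last exact: addr_ge0.
  by rewrite mulr_ge0 ?expR_ge0// divr_ge0// ltW.
have T2 : 'C(n.+1, k.+1)%:R * q ^+ k.+1 <= expR (- (L * s)).
  apply: le_trans (@bin_pow_le _ _ _ _ (p * q) q0 (lexx _)) _.
  rewrite ler_expR; apply: expo.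
  have -> : p * q = expR 2 * alpha * (- ln u + Gam).
    by rewrite /q; field; rewrite gt_eqF.
  rewrite /E mulrDl -[leLHS]addr0; apply: lerD; last first.
    by apply: mulr_ge0; rewrite ?invr_ge0 ltW.
  rewrite -[leRHS]mulrA ler_wpM2l ?mulr_ge0 ?expR_ge0 ?(ltW alpha0)//.
  rewrite lnuE -addrA [leRHS]mulrDl lerD2l mulrAC -mulrA.
  rewrite ler_peMr ?addr_ge0 ?(ltW ln2L)//.
  by rewrite ler_pdivlMr// mul1r.
have T3 : 'C(n.+1, k.+1)%:R * expR (- (eps / p / (t * u))) ^+ k.+1 <=
    expR (- (L * s)).
  apply: le_trans (@bin_pow_le _ _ _ _ 1 (expR_ge0 _) _) _.
    rewrite -/p; have -> : eps / p / (t * u) = eps * p `^ (B + 1).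
      have pBN : p `^ (- (B + 3)) * p `^ (B + 3) = 1.
        by rewrite -powRD ?addNr ?powRr0// (gt_eqF p0) implybT.
      have pB3 : p `^ (B + 3) = p `^ (B + 1) * p ^+ 2.
        rewrite -powR_mulrn ?(ltW p0)// -powRD ?(gt_eqF p0) ?implybT//.
        by congr (_ `^ _); ring.
      have alg (e r l x y : R) :
          r != 0 -> l != 0 -> x != 0 -> x * (y * r ^+ 2) = 1 ->
          e / r / (2 * l * r * (x / (2 * l))) = e * y.
        move=> r0 l0 x0 xy; rewrite -[LHS]mulr1 -[X in _ * X = _]xy; field.
        by rewrite r0 l0 x0.
      by apply: alg; rewrite -?pB3 ?gt_eqF//; lra.
    have ppB : p <= eps * p `^ (B + 1).
      rewrite [leLHS](_ : p = (p `^ B)^-1 * p `^ (B + 1)); last first.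
        rewrite powRD ?(gt_eqF p0) ?implybT// powRr1 ?(ltW p0)//.
        rewrite mulrA mulVf ?mul1r//.
        by rewrite gt_eqF// powR_gt0.
      by rewrite ler_pM2r ?powR_gt0// ltW.
    rewrite expRN ler_pdivrMr ?expR_gt0// mul1r.
    apply: le_trans ppB _; apply: le_trans _ (expR_ge1Dx _); lra.
  rewrite ler_expR; apply: expo.
  apply: (@le_trans _ _ ((ln 2)^-1 * ln p)); last by rewrite ler_pM2r.
  by rewrite mulrC ler_pdivlMr// mul1r.
have T23 : 'C(n.+1, k.+1)%:R * (K * q ^+ k.+1) <= K * expR (- (L * s)).
  by rewrite mulrCA ler_wpM2l.
apply: (@le_trans _ _ ((3 * (K + 1)) * expR (- (L * s)))).
  have := expR_gt0 (- (L * s)); set X := expR (- (L * s)) in T1 T2 T3 T23 *.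
  nra.
have -> : - (L * s) = - (C * s) + (- (M * s) - s) by rewrite /L; ring.
rewrite expRD mulrCA ler_piMr ?expR_ge0//.
rewrite expRD mulrA -[leRHS]mulr1 ler_pM ?expR_ge0 ?mulr_ge0 ?expR_ge0//;
  try lra.
  rewrite expRN ler_pdivrMr ?expR_gt0// mul1r.
  apply: le_trans _ (expR_ge1Dx _).
  apply: (@le_trans _ _ (M * s)); last by rewrite lerDr.
  apply: (@le_trans _ _ (M * (c * ln 2))).
    by rewrite /M divfK// gt_eqF// mulr_gt0.
  rewrite ler_pM2l//; apply: le_trans cs.
  by rewrite ler_pM2l.
by rewrite -[leRHS]expR0 ler_expR oppr_le0 ltW.
Qed.

Theorem lemma7p3 (R : realType) (alpha B c : R) :
  0 < alpha -> 0 < B -> 0 < c ->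
  (exists A C : R, [/\ 0 < A, 0 < C & supp_tail_bound alpha B c A C]) /\
  (forall C : R, 0 < C ->
     exists A0 : R, 0 < A0 /\
       forall A : R, A0 <= A -> supp_tail_bound alpha B c A C).
Proof.
move=> alpha0 B0 c0; split=> [|C C0]; last exact: supp_tail_bound_ge.
have [A [A0 h]] := supp_tail_bound_ge alpha0 B0 c0 ltr01.
by exists A, 1; split=> //; exact: h.
Qed.
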